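(* Let $l=\sum_{i=1}^k c_iH_i$ be an element of $\mathbb{G}$ (with $c_i\in\mathbb{C}$) such that each $H_i$ is a graph with vertex set $[n]$ for some positive integer $n$. Then $l$ is a modular relation for $X$ if and only if for every set partition $\pi$ of $[n]$, $$C(l;\pi)=\sum_{i=1}^k c_i\,\delta_{e_{H_i}(\pi),0}=0,$$ where $e_{H_i}(\pi)$ is the number of edges of $H_i$ (counted with multiplicity) with both endpoints in the same block of $\pi$ and $\delta$ is the Kronecker delta.
   Context: Write $[n]=\{1,\dots,n\}$. A graph is a finite vertex set $V(G)$ together with a finite multiset $E(G)$ of unordered pairs of not necessarily distinct vertices (loops and multi-edges are allowed). $\mathbb{G}$ is the $\mathbb{C}$-vector space freely generated by all (labelled) graphs whose vertex set is $[n]$ for some $n\ge 1$. Chromatic symmetric function: for a graph $G$, $X_G(x_1,x_2,\dots)=\sum_{\kappa}\prod_{v\in V(G)}x_{\kappa(v)}$, where the sum is over all proper colorings, i.e. maps $\kappa:V(G)\to\{1,2,3,\dots\}$ with $\kappa(v_1)\ne\kappa(v_2)$ whenever $v_1v_2\in E(G)$ (so $X_G=0$ if $G$ has a loop). It takes values in the algebra $\Lambda$ of symmetric functions over $\mathbb{C}$; extend linearly to $X:\mathbb{G}\to\Lambda$, with kernel $Ker(X)$. Extension: for a graph $G$ and a multiset $E$ of edges with endpoints in $V(G)$, $G\uplus E$ is the graph with vertex set $V(G)$ and edge multiset $E(G)\uplus E$ (multiplicities are added). For $l=\sum_i c_iH_i$ with all $H_i$ graphs on $[n]$ and a graph $G$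 on $[N]$, $N\ge n$, set $Ext(l;G)=\sum_i c_i\,(G\uplus E(H_i))$. Modular relation: a linear combination $l\in\mathbb{G}$ of graphs with vertex set $[n]$ is a modular relation for $X$ if $Ext(l;G)\in Ker(X)$ for every $N\ge n$ and every graph $G$ with vertex set $[N]$. *)

(* Defs.v *)
From mathcomp Require Import all_boot all_order all_algebra.
From mathcomp Require Import finmap multiset.
From mathcomp Require Import boolp classical_sets functions cardinality fsbigop.
From mathcomp Require Import reals.
From mathcomp Require Import complex.
From mathcomp.multinomials Require Import monalg.
From mathcomp.multinomials Require Import freeg.

Set Implicit Arguments.
Unset Strict Implicit.
Unset Printing Implicit Defensive.

Import GRing.Theory.

Local Open Scope mset_scope.
Local Open Scope ring_scope.

(* An unordered pair of not necessarily distinct vertices is the set of its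
   endpoints; loops are the singletons. *)
Definition edge (V : finType) := {e : {set V} | (0 < #|e| <= 2)%N}.

Definition multigraph (V : finType) := {mset edge V}.

Section Multigraphs.
Variables V W : finType.

Lemma uedge_subproof (v w : V) : (0 < #|[set v; w]| <= 2)%N.
Proof. by rewrite cards2; case: (v != w). Qed.

Definition uedge (v w : V) : edge V := Sub [set v; w] (uedge_subproof v w).

Lemma map_edge_subproof (f : V -> W) (e : edge V) :
  (0 < #|f @: val e| <= 2)%N.
Proof.
case: e => e /= /andP[e_gt0 e_le2].
rewrite (leq_trans (leq_imset_card _ _) e_le2) andbT card_gt0.
by rewrite imset_eq0 -card_gt0.
Qed.

Definition map_edge (f : V -> W) (e : edge V) : edge W :=
  Sub (f @: val e) (map_edge_subproof f e).

Definition map_multigraph (f : V -> W) (H : multigraph V) : multigraph W :=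
  seq_mset [seq map_edge f e | e <- enum_mset H].

Definition proper_coloring (G : multigraph V) (kappa : {ffun V -> nat}) : Prop :=
  forall v w : V, uedge v w \in G -> kappa v <> kappa w.

Definition edges_in_blocks (G : multigraph V) (P : {set {set V}}) : nat :=
  (\sum_(e : edge V | [exists B in P, val e \subset B]) G e)%N.

End Multigraphs.

(* The labelled graphs with a nonempty vertex set: the index n stands for the
   vertex set 'I_n.+1, with vertices numbered from 0. *)
Definition lgraph := {n : nat & multigraph 'I_n.+1}.

Definition lgraph_of (n : nat) (H : multigraph 'I_n.+1) : lgraph :=
  Tagged (fun m => multigraph 'I_m.+1) H.

Section ChromaticSymmetricFunction.
Variable R : realType.

(* Formal power series over the complex numbers in countably many commuting
   variables, given by their coefficients; the variable of index j : nat is the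
   one usually written x_(j+1). *)
Definition mpseries := cmonom nat -> R[i].

Definition symmetric_function (f : mpseries) : Prop :=
  (exists d : nat, forall m : cmonom nat, (d < mdeg m)%N -> f m = 0) /\
  (forall s : nat -> nat, bijective s ->
   forall m m' : cmonom nat, (forall j, m' (s j) = m j) -> f m' = f m).

Definition coloring_monomial (V : finType) (kappa : {ffun V -> nat}) : cmonom nat :=
  \big[@mmul _/@mone _]_(v : V) ucm (kappa v).

(* The sum over all proper colorings is taken coefficientwise; only finitely
   many colorings contribute to a given coefficient, by
   finite_coloring_monomial below. *)
Definition chromatic (V : finType) (G : multigraph V) : mpseries :=
  fun m => \sum_(kappa \in [set kappa | proper_coloring G kappa]%classic)
             ((coloring_monomial kappa == m)%:R : R[i]).

Definition graph_space := {freeg lgraph / R[i]}.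

Definition graph_vect (H : lgraph) : graph_space := [freeg [:: (1, H)]].

(* Linear extension; by chromatic_lin_symmetric below, its values are symmetric
   functions, so that its kernel does not depend on whether mpseries or its
   subspace of symmetric functions is taken as codomain. *)
Definition chromatic_lin (l : graph_space) : mpseries :=
  fglift (fun H : lgraph => chromatic (tagged H)) l.

Definition in_Ker_chromatic (l : graph_space) : Prop := chromatic_lin l = 0.

(* The edges of H are read in 'I_N.+1 through inord, which is the inclusion of
   'I_n.+1 in 'I_N.+1 when n <= N; extend is not used otherwise. *)
Definition extend (N : nat) (G : multigraph 'I_N.+1) (H : lgraph) : lgraph :=
  lgraph_of (G `+` map_multigraph (fun i : 'I_(tag H).+1 => inord i) (tagged H)).

Definition Ext (l : graph_space) (N : nat) (G : multigraph 'I_N.+1) :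
    graph_space :=
  fglift (fun H : lgraph => graph_vect (extend G H)) l.

Definition modular_relation (n : nat) (l : graph_space) : Prop :=
  (forall H : lgraph, H \in dom l -> tag H = n) /\
  (forall (N : nat) (G : multigraph 'I_N.+1), (n <= N)%N ->
     in_Ker_chromatic (Ext l G)).

Lemma coloring_monomialE (V : finType) (kappa : {ffun V -> nat}) (j : nat) :
  coloring_monomial kappa j = #|[set v | kappa v == j]|.
Proof.
rewrite /coloring_monomial (big_morph (fun m : cmonom nat => m j)
  (id1 := 0%N) (op1 := addn)); last 2 first.
- by move=> x y; rewrite cmM.
- by rewrite cm1.
rewrite -sum1_card [RHS]big_mkcond /=; apply: eq_bigr => v _.
by rewrite cmU inE; case: eqP.
Qed.

Lemma finite_coloring_monomial (V : finType) (m : cmonom nat) :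
  finite_set [set kappa : {ffun V -> nat} | coloring_monomial kappa = m]%classic.
Proof.
apply: (@sub_finite_set _ _
  ((fun k : {ffun V -> finsupp m} => [ffun v => val (k v)]) @` [set: _])%classic).
  move=> kappa /= mE.
  have km v : kappa v \in finsupp m.
    rewrite -cmE_neq0 -mE coloring_monomialE -lt0n card_gt0.
    by apply/set0Pn; exists v; rewrite inE.
  exists [ffun v => FSetSub (km v)] => //.
  by apply/ffunP => v; rewrite !ffunE.
exact/finite_image/finite_finset.
Qed.

Lemma chromatic_symmetric (V : finType) (G : multigraph V) :
  symmetric_function (chromatic G).
Proof.
split.
  exists #|V| => m m_gt; apply: fsbig1 => kappa _.
  case: eqP => // mE; move: m_gt; rewrite -mE mdeg_prod.
  by rewrite (eq_bigr (fun=> 1%N)) ?sum1_card ?ltnn // => v _; rewrite mdegU.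
move=> s [t sK tK] m m' m'E; rewrite /chromatic.
pose h (k : {ffun V -> nat}) : {ffun V -> nat} := [ffun v => s (k v)].
have h_bij : set_bij [set k | proper_coloring G k]%classic
                     [set k | proper_coloring G k]%classic h.
  split.
  - move=> k /= kP v w vw; rewrite !ffunE => /(can_inj sK).
    exact: kP.
  - move=> k1 k2 _ _ /ffunP k12; apply/ffunP => v.
    by have := k12 v; rewrite !ffunE => /(can_inj sK).
  - move=> k /= kP; exists [ffun v => t (k v)] => /=.
      move=> v w vw; rewrite !ffunE => /(can_inj tK).
      exact: kP.
    by apply/ffunP => v; rewrite !ffunE tK.
rewrite (reindex_fsbig _ _ _ _ h_bij); apply: eq_fsbigr => k _ /=.
congr (_%:R : R[i]); congr nat_of_bool.
have hE j : coloring_monomial (h k) (s j) = coloring_monomial k j.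
  rewrite !coloring_monomialE; apply: eq_card => v.
  by rewrite !inE ffunE (can_eq sK).
apply/cmP/cmP => E j; first by rewrite -hE E m'E.
by rewrite -(tK j) hE m'E E.
Qed.

Lemma chromatic_lin_symmetric (l : graph_space) :
  symmetric_function (chromatic_lin l).
Proof.
rewrite -[l]Freeg_dom /chromatic_lin fglift_Freeg /prelift big_map /=.
elim/big_ind: _ => [|f g [[d fd] fs] [[e ge] gs]|H _].
- by split=> [|//]; exists 0%N.
- split=> [|s bs m m' mE].
    exists (maxn d e) => m; rewrite gtn_max => /andP[dm em].
    by rewrite -[LHS]/(f m + g m) (fd _ dm) (ge _ em) addr0.
  by rewrite -[LHS]/(f m' + g m') (fs _ bs _ _ mE) (gs _ bs _ _ mE).
have [[d fd] fs] := chromatic_symmetric (tagged H).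
split=> [|s bs m m' mE].
  exists d => m dm.
  by rewrite -[LHS]/(coeff H l * chromatic (tagged H) m) (fd _ dm) mulr0.
by rewrite -[LHS]/(coeff H l * chromatic (tagged H) m') (fs _ bs _ _ mE).
Qed.

End ChromaticSymmetricFunction.

(* Main.v *)
Require Import Defs.
From HB Require Import structures.
From mathcomp Require Import finmap multiset.
From mathcomp Require Import boolp classical_sets functions cardinality fsbigop.
From mathcomp Require Import all_boot all_order all_algebra.
From mathcomp Require Import reals complex.
From mathcomp.multinomials Require Import monalg.
From mathcomp.multinomials Require Import freeg.

(** Modulo linearity, the coefficient of [m] in the chromatic function of
    [G + H_i] counts the colorings [kappa] with monomial [m] that are proper for
    [G] and whose color classes form a partition [P] with no edge of [H_i] inside
    a block.  Exchanging sums, the coefficient of [m] in X(Ext(l;G)) is the sum of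
    C(l; ker kappa) over the proper colorings [kappa] of [G] with monomial [m];
    hence the condition on C is sufficient.  Conversely, given [P], let [G] be the
    complete multipartite graph with parts the blocks of [P], and let [m] be the
    monomial of a coloring with color classes the blocks of [P].  A proper
    coloring of [G] with monomial [m] has kernel contained in that of [P], and as
    many monochromatic pairs of vertices, hence kernel [P]: the coefficient is a
    positive multiple of C(l; P). *)

Set Implicit Arguments.
Unset Strict Implicit.
Unset Printing Implicit Defensive.

Import GRing.Theory Num.Theory.

Local Open Scope ring_scope.

(** Whether an edge is monochromatic depends on its set of endpoints only, not on the pair chosen to
    write it. *)
Lemma eq_uedge (V : finType) (T : Type) (k : V -> T) v w v' w' :
  uedge v w = uedge v' w' -> k v = k w -> k v' = k w'.
Proof.
move=> /(congr1 val) /= vw kvw.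
have: v' \in [set v; w] by rewrite vw set21.
have: w' \in [set v; w] by rewrite vw set22.
by rewrite !inE => /orP[] /eqP-> /orP[] /eqP->.
Qed.

Section Edges.
Variables V W : finType.

Lemma edge_uedgeP (e : edge V) : exists v w, e = uedge v w.
Proof.
have := valP e; case e2: (#|val e|) => [|[|[|//]]] // _.
- have /eqP/cards1P[v ev] := e2; exists v, v.
  by apply: val_inj; rewrite /= setUid.
- by have /eqP/cards2P[v [w [_ ev]]] := e2; exists v, w; apply: val_inj.
Qed.

Lemma map_edge_uedge (f : V -> W) v w :
  map_edge f (uedge v w) = uedge (f v) (f w).
Proof. by apply: val_inj; rewrite /= imsetU1 imset_set1. Qed.

(** The added edges are the images [f v], [f w] of the edges of [H], so they constrain [kappa]
    exactly as [H] constrains its pullback along [f]. *)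
Lemma proper_coloring_add_map (G : multigraph W) (H : multigraph V)
    (f : V -> W) (kappa : {ffun W -> nat}) :
  proper_coloring (G `+` map_multigraph f H)%mset kappa <->
  proper_coloring G kappa /\ proper_coloring H [ffun v => kappa (f v)].
Proof.
have memM e :
    (e \in map_multigraph f H) = (e \in [seq map_edge f e | e <- enum_mset H]).
  exact/perm_mem/perm_eq_seq_mset.
split=> [kP | [kG kH] v w].
  split=> v w vw; last rewrite !ffunE; apply: kP; rewrite in_msetD ?vw // memM.
  by rewrite -map_edge_uedge map_f ?orbT.
rewrite in_msetD => /orP[/kG //|].
rewrite memM => /mapP[e eH]; have [v' [w' eE]] := edge_uedgeP e.
rewrite eE map_edge_uedge => vwE kvw.
have := kH v' w'; rewrite !ffunE -eE => /(_ eH); apply.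
exact: eq_uedge vwE kvw.
Qed.

End Edges.

Section Kernel.
Variable V : finType.

Lemma mem_pblock_preim (T : eqType) (f : V -> T) (v w : V) :
  (w \in pblock (preim_partition f [set: V]) v) = (f v == f w).
Proof.
rewrite pblock_equivalence_partition ?inE //.
by move=> x y z _ _ _; split=> // /eqP->.
Qed.

Lemma uedge_in_block_preim (T : eqType) (f : V -> T) (v w : V) :
  [exists B in preim_partition f [set: V], val (uedge v w) \subset B] =
  (f v == f w).
Proof.
have [/eqP cP tP _] := and3P (preim_partitionP f [set: V]).
rewrite -mem_pblock_preim; apply/existsP/idP => [[B /andP[BP]]|vw].
  rewrite subUset !sub1set => /andP[vB wB].
  by rewrite (def_pblock tP BP vB).
have vc : v \in cover (preim_partition f [set: V]) by rewrite cP.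
exists (pblock (preim_partition f [set: V]) v).
by rewrite pblock_mem //= subUset !sub1set mem_pblock vc.
Qed.

Lemma edges_in_blocks_preimP (H : multigraph V) (kappa : {ffun V -> nat}) :
  proper_coloring H kappa <->
  edges_in_blocks H (preim_partition kappa [set: V]) = 0%N.
Proof.
rewrite /edges_in_blocks; split=> [kP|/eqP].
  apply: big1 => e; have [v [w ->]] := edge_uedgeP e.
  rewrite uedge_in_block_preim => /eqP kvw.
  by apply/eqP; rewrite -leqn0 leqNgt mset_gt0; apply/negP => /kP.
rewrite sum_nat_eq0 => /forallP H0 v w vw kvw.
have := H0 (uedge v w).
by rewrite uedge_in_block_preim kvw eqxx /= -leqn0 leqNgt mset_gt0 vw.
Qed.

Lemma perm_codom_coloring_monomial (kappa kappa' : {ffun V -> nat}) :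
  coloring_monomial kappa = coloring_monomial kappa' ->
  perm_eq (codom kappa) (codom kappa').
Proof.
move=> E.
have cE (k : {ffun V -> nat}) j : count_mem j (codom k) = coloring_monomial k j.
  rewrite coloring_monomialE count_map -sum1_count big_enum_cond -sum1_card.
  by apply: eq_bigl => v; rewrite !inE.
by apply/allP => j _ /=; rewrite !cE E.
Qed.

(** Each vertex is paired with its whole color class. As [codom] repeats a color once per vertex,
    the count depends on the monomial only. *)
Lemma card_monochromatic_pairs (kappa : {ffun V -> nat}) :
  #|[set p : V * V | kappa p.1 == kappa p.2]| =
  (\sum_(j <- codom kappa) coloring_monomial kappa j)%N.
Proof.
transitivity (\sum_v \sum_w (kappa v == kappa w))%N.
  rewrite pair_bigA /= -sum1_card big_mkcond /=.
  by apply: eq_bigr => p _; rewrite inE; case: eqP.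
rewrite big_map big_enum /=; apply: eq_bigr => v _.
rewrite coloring_monomialE -sum1_card [RHS]big_mkcond /=.
by apply: eq_bigr => w _; rewrite inE eq_sym; case: eqP.
Qed.

Lemma eq_kernel_coloring_monomial (kappa kappa' : {ffun V -> nat}) :
  coloring_monomial kappa = coloring_monomial kappa' ->
  (forall v w, kappa v = kappa w -> kappa' v = kappa' w) ->
  forall v w, (kappa v == kappa w) = (kappa' v == kappa' w).
Proof.
move=> E sub v w.
have /eqP/setP/(_ (v, w)) :
    [set p : V * V | kappa p.1 == kappa p.2] ==
    [set p : V * V | kappa' p.1 == kappa' p.2]; last by rewrite !inE.
(* One set of monochromatic pairs contains the other, and equal monomials give them the same
   size. *)
rewrite eqEcard !card_monochromatic_pairs E.
rewrite (perm_big _ (perm_codom_coloring_monomial E)) leqnn andbT.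
by apply/subsetP => p; rewrite !inE => /eqP/sub->.
Qed.

End Kernel.

Section FreeLift.
Variables (K : nzRingType) (T : choiceType) (M : lmodType K) (f : T -> M).

HB.instance Definition _ :=
  GRing.isAdditive.Build {freeg T / K} M (fglift f) (lift_is_additive f).

Lemma fglift_sumZ (I : Type) (r : seq I) (c : I -> K) (x : I -> T) :
  fglift f (\sum_(i <- r) c i *: [freeg [:: (1, x i)]]) =
  \sum_(i <- r) c i *: f (x i).
Proof.
rewrite raddf_sum; apply: eq_bigr => i _ /=; rewrite -liftU; congr (fglift f _).
by apply/eqP/freeg_eqP => y; rewrite coeffZ !coeffU mul1r.
Qed.

End FreeLift.

Section Chromatic.
Variable R : realType.

(** The index set is finite and independent of [G], which allows the sum over colorings to be
    exchanged with the sum over the graphs of a linear combination. *)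
Lemma chromatic_fset (V : finType) (G : multigraph V) (m : cmonom nat) :
  chromatic R G m =
  \sum_(kappa <- fset_set [set kappa : {ffun V -> nat} |
                            coloring_monomial kappa = m]%classic)
     (`[< proper_coloring G kappa >])%:R.
Proof.
rewrite -fsbig_finite /=; last exact: finite_coloring_monomial.
rewrite /chromatic fsbig_mkcond [RHS]fsbig_mkcond; apply: eq_fsbigr => k _ /=.
rewrite /patch (_ : (k \in _) = `[< proper_coloring G k >]) //.
rewrite (_ : (k \in _) = (coloring_monomial k == m)).
  by case: asboolP => _; case: eqP.
by apply/idP/eqP; rewrite in_setE.
Qed.

Lemma chromatic_lin_Ext (n k N : nat) (c : 'I_k -> R[i])
    (H : 'I_k -> multigraph 'I_n.+1) (G : multigraph 'I_N.+1) (m : cmonom nat) :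
  chromatic_lin
    (Ext (\sum_(i < k) c i *: graph_vect R (lgraph_of (H i))) G) m =
  \sum_(i < k) c i *
    chromatic R (G `+` map_multigraph (fun v : 'I_n.+1 => inord v) (H i))%mset m.
Proof.
by rewrite /Ext fglift_sumZ /chromatic_lin fglift_sumZ fct_sumE.
Qed.

Lemma chromatic_lin_ExtE (n k N : nat) (c : 'I_k -> R[i])
    (H : 'I_k -> multigraph 'I_n.+1) (G : multigraph 'I_N.+1) (m : cmonom nat) :
  chromatic_lin
    (Ext (\sum_(i < k) c i *: graph_vect R (lgraph_of (H i))) G) m =
  \sum_(kappa <- fset_set [set kappa : {ffun 'I_N.+1 -> nat} |
                            coloring_monomial kappa = m]%classic |
        `[< proper_coloring G kappa >])
    \sum_(i < k) c i *
      (edges_in_blocks (H i)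
         (preim_partition [ffun v : 'I_n.+1 => kappa (inord v)] [set: 'I_n.+1])
       == 0%N)%:R.
Proof.
rewrite chromatic_lin_Ext.
under eq_bigr do rewrite chromatic_fset mulr_sumr.
rewrite exchange_big [RHS]big_mkcond /=; apply: eq_bigr => kappa _.
case: (asboolP (proper_coloring G kappa)) => kG;
  [apply: eq_bigr | apply: big1] => i _.
  congr (_ * _%:R); congr nat_of_bool; apply/asboolP/eqP.
    by move=> /proper_coloring_add_map[_ /edges_in_blocks_preimP].
  move=> H0; apply/proper_coloring_add_map; split=> //.
  exact/edges_in_blocks_preimP.
(* A coloring that is not proper for [G] is not proper for any extension of [G], so it contributes
   nothing. *)
case: asboolP => [/proper_coloring_add_map[//]|_]; exact: mulr0.
Qed.

Lemma dom_sumZ_graph_vect (n k : nat) (c : 'I_k -> R[i])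
    (H : 'I_k -> multigraph 'I_n.+1) (K : lgraph) :
  K \in dom (\sum_(i < k) c i *: graph_vect R (lgraph_of (H i))) -> tag K = n.
Proof.
move=> /dom_sum_subset/flatten_mapP[i _ /domZ_subset].
by rewrite domU1 inE => /eqP->.
Qed.

End Chromatic.

Lemma coloring_monomial_forces_kernel (V : finType) (P : {set {set V}}) :
  partition P [set: V] ->
  exists (G : multigraph V) (kappa0 : {ffun V -> nat}),
    proper_coloring G kappa0 /\
    forall kappa : {ffun V -> nat}, proper_coloring G kappa ->
      coloring_monomial kappa = coloring_monomial kappa0 ->
      preim_partition kappa [set: V] = P.
Proof.
move=> partP; have [/eqP cP tP _] := and3P partP.
(* The complete multipartite graph on the blocks of [P]; it has no loops, since each singleton lies
   in a block. *)
pose G : multigraph V := seq_mset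
  [seq e : edge V <- enum {: edge V} |
       ~~ [exists B in P, val e \subset B]].
have memG v w : (uedge v w \in G) = (pblock P v != pblock P w).
  rewrite (perm_mem (perm_eq_seq_mset _)) mem_filter mem_enum andbT.
  (* [P] is the kernel of the map sending a vertex to its block. *)
  rewrite -[in X in ~~ X](preim_partition_pblock partP).
  by rewrite uedge_in_block_preim.
pose kappa0 := [ffun v : V => index (pblock P v) (enum P)].
have kappa0E v w :
    (kappa0 v == kappa0 w) = (pblock P v == pblock P w).
  rewrite !ffunE; apply/eqP/eqP => [|->//].
  by apply: (index_inj set0); rewrite mem_enum pblock_mem ?cP.
exists G, kappa0; split=> [v w|kappa kG E].
  by rewrite memG -kappa0E => /eqP.
rewrite -[RHS](preim_partition_pblock partP).
have ker v w : (kappa v == kappa w) = (pblock P v == pblock P w).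
  rewrite -kappa0E; apply: eq_kernel_coloring_monomial => // {}v {}w kvw.
  (* Two vertices in distinct blocks are adjacent in [G], so they cannot share a color of
     [kappa]. *)
  apply/eqP; rewrite kappa0E; apply/negPn/negP.
  by rewrite -memG => /kG/(_ kvw).
rewrite /preim_partition /equivalence_partition.
by apply: eq_imset => v; apply/setP => w; rewrite !inE ker.
Qed.

Theorem corollary5 (R : realType) (n k : nat) (c : 'I_k -> R[i])
    (H : 'I_k -> multigraph 'I_n.+1) :
  modular_relation n (\sum_(i < k) c i *: graph_vect R (lgraph_of (H i)))
  <->
  (forall P : {set {set 'I_n.+1}}, partition P [set: 'I_n.+1] ->
     \sum_(i < k) c i * (edges_in_blocks (H i) P == 0%N)%:R = 0).
Proof.
split=> [[_ mod0] P partP|C0].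
  have [G [kappa0 [k0G kerP]]] := coloring_monomial_forces_kernel partP.
  (* Extensions with [N = n] suffice: there [inord] is the identity. *)
  have := congr1 (fun f => f (coloring_monomial kappa0)) (mod0 n G (leqnn n)).
  rewrite chromatic_lin_ExtE big_seq_cond.
  set S := fset_set _.
  have memS kappa :
      (kappa \in S) = (coloring_monomial kappa == coloring_monomial kappa0).
    rewrite in_fset_set; last exact: finite_coloring_monomial.
    by apply/idP/eqP; rewrite in_setE.
  rewrite (eq_bigr (fun=>
    \sum_(i < k) c i * (edges_in_blocks (H i) P == 0%N)%:R)).
    (* The coefficient is a natural multiple of C(l; [P]). In characteristic 0 one factor vanishes,
       and the multiplicity does not, as [kappa0] is counted. *)
    rewrite big_const_seq iter_addr_0 => /eqP.
    rewrite mulrn_eq0 => /orP[|/eqP//].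
    rewrite -leqn0 leqNgt -has_count => /hasPn/(_ kappa0).
    by rewrite memS eqxx /=; case: asboolP => // _ /(_ isT).
  move=> kappa /andP[]; rewrite memS => /eqP kE /asboolP kG.
  rewrite (_ : [ffun v => _] = kappa) ?kerP //.
  by apply/ffunP => v; rewrite ffunE inord_val.
split=> [K|N G _]; first exact: dom_sumZ_graph_vect.
(* Each inner sum is C(l; .) at the kernel of the restriction of [kappa] to the vertices of the
   [H i]. *)
apply/funext => m; rewrite chromatic_lin_ExtE big1 // => kappa _.
exact/C0/preim_partitionP.
Qed.
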